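(* Let $n\in\mathbb{N}$. There exists some $d\in\mathbb{N}$ and some convex $L$-$\mathrm{QG}^+$ function $f$ of input space $\mathbb{R}^d$ such that: for any sequence $(x_k)_{0\le k\le n}$ satisfying $$x_k-x_0\in\operatorname{span}\{g_0,g_1,g_2,\dots,g_{k-1}\}\quad\text{for all } k\le n,\qquad\text{with } g_i\in\partial f(x_i)\ (i=0,\dots,k-1),$$ we have $$f(x_n)-f_\star\ \ge\ \frac L2\,\frac1{n+1}\,d(x_0,\mathcal{X}_\star)^2 .$$
   Context: The functions $f:\mathbb{R}^d\to\mathbb{R}$ considered are convex (closed, proper) and are assumed to have a non-empty set of global minimizers $\mathcal{X}_\star$; $f_\star=\min_{x} f(x)$; $d(x,\mathcal{X}_\star)=\min_{x_\star\in\mathcal{X}_\star}\|x-x_\star\|_2$. The function $f$ is $L$-quadratically upper bounded ($L$-$\mathrm{QG}^+$) if $f(x)-f_\star\le\frac L2 d(x,\mathcal{X}_\star)^2$ for all $x\in\mathbb{R}^d$. $\partial f(x)=\{g:\ f(y)\ge f(x)+\langle g,y-x\rangle\ \forall y\in\mathbb{R}^d\}$ is the subdifferential. *)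

(* Defs.v *)
(* MathComp-Analysis, over an arbitrary R : realType. *)
From HB Require Import structures.
From mathcomp Require Import all_boot all_order all_algebra.
From mathcomp Require Import all_classical all_reals all_analysis.
Import Order.TTheory GRing.Theory Num.Theory.
Import numFieldNormedType.Exports.

Set Implicit Arguments.
Unset Strict Implicit.
Unset Printing Implicit Defensive.

Local Open Scope classical_set_scope.
Local Open Scope ring_scope.

Section definitions.
Context {R : realType} {d : nat}.
Implicit Types (x y g : 'rV[R]_d) (A : set 'rV[R]_d) (f : 'rV[R]_d -> R).

Definition inner x y : R := \sum_(i < d) x 0 i * y 0 i.

(* The library's `|x| on matrices is the sup norm, not the Euclidean norm. *)
Definition norm2 x : R := Num.sqrt (inner x x).

(* The infimum is a minimum when A is nonempty and closed; inf set0 = 0. *)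
Definition dist2 x A : R := inf [set norm2 (x - y) | y in A].

Definition argmin f : set 'rV[R]_d := [set x | forall y, f x <= f y].

(* Equal to f at any point of argmin f. *)
Definition minval f : R := inf (range f).

Definition subdifferential f x : set 'rV[R]_d :=
  [set g | forall y, f x + inner g (y - x) <= f y].

(* Real-valued functions are proper; closed means lower semicontinuous. *)
Definition closed_convex f : Prop :=
  convex_function setT f /\ lower_semicontinuous (EFin \o f).

Definition QGplus (L : R) f : Prop :=
  forall x, f x - minval f <= L / 2 * dist2 x (argmin f) ^+ 2.

(* x 0, ..., x n and g 0, ..., g (n-1) are the only relevant terms. *)
Definition span_iterates (n : nat) (x g : nat -> 'rV[R]_d) : Prop :=
  forall k : nat, (k <= n)%N -> x k - x 0%N \in <<mkseq g k>>%VS.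

End definitions.

(* On the two parts of the lower bound. Quantifying over every starting point
   and every choice of subgradients is the verbatim reading, but a constant
   function satisfies it trivially, and for n >= 1 nothing else does (nor does
   it help to fix a starting point x0 outside argmin f while still allowing
   every choice of subgradients: already for n = 1 this is impossible).
   The nontrivial content is the usual oracle-complexity one: some first-order
   oracle of f, returning one subgradient at each point, and some
   non-minimizing x0 for which every span-based sequence is slow. Both are
   asserted. *)

(* Main.v *)
(* The squared sup norm f(x) = (L/2) |x|_oo^2 on R^(n+1) is the bad function: if
   the coordinate j of x attains the sup norm, then L x_j e_j is a subgradient at
   x, so n calls to this oracle reveal at most n coordinates. Started at the
   all-ones vector, which is at squared distance n+1 from the minimizer 0, an
   iterate after n steps still has a coordinate equal to 1. The clause with arbitrary
   subgradients is only satisfied degenerately: dimension 0 is used there. *)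
Require Import Defs.
From HB Require Import structures.
From mathcomp Require Import all_boot all_order all_algebra.
From mathcomp Require Import all_classical all_reals all_analysis.
From mathcomp Require Import ring.
Import Order.TTheory GRing.Theory Num.Theory.
Import numFieldNormedType.Exports.

Local Open Scope classical_set_scope.
Local Open Scope ring_scope.

Section inner_norm2.
Context {R : realType} {d : nat}.
Implicit Types x y : 'rV[R]_d.

Lemma inner_deltal (a : R) (j : 'I_d) y :
  inner (a *: delta_mx 0 j) y = a * y 0 j.
Proof.
rewrite /inner (bigD1 j) //= big1 => [|i ij]; first by rewrite !mxE !eqxx mulr1 addr0.
by rewrite !mxE (negbTE ij) andbF mulr0 mul0r.
Qed.

Lemma sqr_norm2 x : norm2 x ^+ 2 = inner x x.
Proof. by rewrite sqr_sqrtr// sumr_ge0// => i _; rewrite -expr2 sqr_ge0. Qed.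

Lemma dist2_set1 x y : dist2 x [set y] = norm2 (x - y).
Proof. by rewrite /dist2 image_set1 inf1. Qed.

Lemma ler_coord_norm x j : `|x 0 j| <= `|x|.
Proof.
by rewrite [leRHS]/Num.norm /= mx_normrE; apply/bigmax_geP; right; exists (0, j).
Qed.

(** Each squared coordinate is one summand of [inner x x]; taking square roots first lets the
    maximum be bounded entry by entry. This comparison of norms is what yields [QGplus]. *)
Lemma sqr_normr_le_inner x : `|x| ^+ 2 <= inner x x.
Proof.
have inner_ge0 : 0 <= inner x x by rewrite -sqr_norm2 sqr_ge0.
rewrite -ler_sqrt// sqrtr_sqr normr_id [leLHS]/Num.norm /= mx_normrE.
apply: bigmax_le => [|[i j] _ /=]; first exact: sqrtr_ge0.
rewrite ord1 -sqrtr_sqr ler_sqrt// /inner (bigD1 j)//= expr2 lerDl.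
by rewrite sumr_ge0// => k _; rewrite -expr2 sqr_ge0.
Qed.

End inner_norm2.

(** Supplies the coordinate on which the oracle answers. The dimension is a successor so that an
    index exists even for the zero vector, where any index works. *)
Lemma norm_attained (R : realType) (d : nat) (x : 'rV[R]_d.+1) :
  exists j, `|x 0 j| = `|x|.
Proof.
have [x0|/mx_norm_neq0[[i j] /= xE]] := eqVneq `|x| 0.
  by exists 0; apply/le_anti; rewrite ler_coord_norm x0 normr_ge0.
by exists j; rewrite [RHS]xE ord1.
Qed.

(** Vanishing at coordinate [j] is a linear condition, so it passes from generators to their
    span. *)
Lemma span_coord_eq0 (R : realType) (d : nat) (X : seq 'rV[R]_d) (v : 'rV[R]_d)
    (j : 'I_d) :
  (forall u, u \in X -> u 0 j = 0) -> v \in <<X>>%VS -> v 0 j = 0.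
Proof.
move=> X0 /(@coord_span _ _ _ (in_tuple X)) ->.
by rewrite summxE big1// => i _; rewrite mxE X0 ?mulr0// mem_nth.
Qed.

Lemma exists_notin (T : finType) (s : seq T) :
  (size s < #|T|)%N -> exists j, j \notin s.
Proof.
move=> sT; apply/existsP; rewrite -negb_forall; apply/negP => /forallP sall.
have /fintype.subset_leq_card : T \subset s by apply/fintype.subsetP => x _.
by rewrite leqNgt (leq_ltn_trans (card_size s) sT).
Qed.

Section sup_norm_square.
Context {R : realType} {d : nat} (L : R).

Definition supsq (x : 'rV[R]_d) : R := L / 2 * `|x| ^+ 2.

Lemma supsq0 : supsq 0 = 0.
Proof. by rewrite /supsq normr0 expr0n mulr0. Qed.

Lemma supsq_ge0 (L_gt0 : 0 < L) x : 0 <= supsq x.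
Proof. by rewrite mulr_ge0 ?sqr_ge0// divr_ge0// ltW. Qed.

Lemma supsq_conv_le (L_gt0 : 0 < L) x y (t : R) : 0 <= t -> t <= 1 ->
  supsq (t *: x + (1 - t) *: y) <= t * supsq x + (1 - t) * supsq y.
Proof.
move=> t0 t1; rewrite /supsq [X in _ <= X + _]mulrCA [X in _ <= _ + X]mulrCA -mulrDr.
rewrite ler_wpM2l//; first by rewrite divr_ge0// ltW.
(* The triangle inequality, squared, reduces the claim to convexity of the scalar square at [|x|]
   and [|y|]. *)
apply: (@le_trans _ _ ((t * `|x| + (1 - t) * `|y|) ^+ 2)).
  rewrite lerXn2r ?nnegrE ?addr_ge0 ?mulr_ge0 ?subr_ge0//.
  by rewrite (le_trans (ler_normD _ _))// !normrZ !ger0_norm ?subr_ge0.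
rewrite -subr_ge0 [leRHS](_ : _ = t * (1 - t) * (`|x| - `|y|) ^+ 2); last by ring.
by rewrite mulr_ge0 ?sqr_ge0// mulr_ge0// subr_ge0.
Qed.

Lemma closed_convex_supsq (L_gt0 : 0 < L) : closed_convex supsq.
Proof.
split.
  move=> t x y _ _; have t0 : 0 <= t%:num by [].
  have t1 : t%:num <= 1 by [].
  exact: supsq_conv_le.
have csupsq : continuous supsq.
  move=> x; have normx := @norm_continuous _ 'rV[R]_d x.
  exact: (cvgM (cvg_cst (L / 2)) (cvgM normx normx)).
move=> x a; rewrite /= lte_fin => ax.
exists [set y | a < supsq y] => [|y]; last by rewrite /= lte_fin.
exact: cvgr_gt (csupsq x) _ ax.
Qed.

Lemma argmin_supsq (L_gt0 : 0 < L) : argmin supsq = [set 0].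
Proof.
apply/seteqP; split => [x /(_ 0)|x -> y]; last by rewrite supsq0 supsq_ge0.
rewrite supsq0 => x0; have /eqP : supsq x = 0 by apply/eqP; rewrite eq_le x0 supsq_ge0.
rewrite /supsq !mulf_eq0 orbb normr_eq0 invr_eq0 pnatr_eq0 gt_eqF//=.
by move/eqP.
Qed.

Lemma minval_supsq (L_gt0 : 0 < L) : minval supsq = 0.
Proof.
apply/le_anti/andP; split.
  apply: ge_inf; last by exists 0 => //; exact: supsq0.
  by exists 0 => _ [x _ <-]; exact: supsq_ge0.
by apply: lb_le_inf => [|_ [x _ <-]]; [exists (supsq 0), 0 | exact: supsq_ge0].
Qed.

Lemma QGplus_supsq (L_gt0 : 0 < L) : QGplus L supsq.
Proof.
move=> x; rewrite minval_supsq// argmin_supsq// dist2_set1 !subr0 sqr_norm2.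
by rewrite ler_wpM2l ?sqr_normr_le_inner// divr_ge0// ltW.
Qed.

(** The function [supsq] dominates the smooth convex function sending [y] to [L / 2 * y 0 j ^+ 2]
    and agrees with it at [x], so the gradient of the latter at [x] is a subgradient of the
    former. *)
Lemma subdifferential_supsq (L_gt0 : 0 < L) (x : 'rV[R]_d) (j : 'I_d) :
    `|x 0 j| = `|x| ->
  subdifferential supsq x ((L * x 0 j) *: delta_mx 0 j).
Proof.
move=> xj y; rewrite inner_deltal !mxE /supsq -xj real_normK ?num_real//.
have yj : y 0 j ^+ 2 <= `|y| ^+ 2.
  by rewrite -[leLHS]real_normK ?num_real// lerXn2r ?nnegrE// ler_coord_norm.
(* The first term is the gap between the two functions at [y], the second the gap between the scalar
   square and its tangent at [x 0 j]. *)
rewrite -subr_ge0 [leRHS](_ : _ =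
  L / 2 * ((`|y| ^+ 2 - y 0 j ^+ 2) + (y 0 j - x 0 j) ^+ 2)); last by field.
rewrite mulr_ge0 ?divr_ge0 ?(ltW L_gt0)//.
by rewrite addr_ge0 ?sqr_ge0// subr_ge0.
Qed.

End sup_norm_square.

Theorem theorem2p3 (R : realType) (L : R) (hL : 0 < L) (n : nat) :
  (exists (d : nat) (f : 'rV[R]_d -> R),
    [/\ closed_convex f, argmin f !=set0, QGplus L f &
      forall x g : nat -> 'rV[R]_d,
        (forall i : nat, (i < n)%N -> subdifferential f (x i) (g i)) ->
        span_iterates n x g ->
        f (x n) - minval f >=
          L / 2 * (1 / n.+1%:R) * dist2 (x 0%N) (argmin f) ^+ 2])
  /\
  (exists (d : nat) (f : 'rV[R]_d -> R),
    [/\ closed_convex f, argmin f !=set0, QGplus L f &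
      exists (oracle : 'rV[R]_d -> 'rV[R]_d) (x0 : 'rV[R]_d),
        [/\ forall y : 'rV[R]_d, subdifferential f y (oracle y),
            ~ argmin f x0 &
            forall x : nat -> 'rV[R]_d,
              x 0%N = x0 ->
              span_iterates n x (fun i => oracle (x i)) ->
              f (x n) - minval f >=
                L / 2 * (1 / n.+1%:R) * dist2 x0 (argmin f) ^+ 2]]).
Proof.
split.
  exists 0%N, (supsq L); split.
  - exact: closed_convex_supsq.
  - by rewrite argmin_supsq//; exists 0.
  - exact: QGplus_supsq.
  move=> x g _ _; rewrite minval_supsq// argmin_supsq// dist2_set1 sqr_norm2.
  (* In dimension 0 the squared distance is an empty sum. *)
  by rewrite /inner big_ord0 mulr0 subr0 supsq_ge0.
exists n.+1, (supsq L); split.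
- exact: closed_convex_supsq.
- by rewrite argmin_supsq//; exists 0.
- exact: QGplus_supsq.
have [piv pivP] := choice (@norm_attained R n).
exists (fun y : 'rV[R]_n.+1 => (L * y 0 (piv y)) *: delta_mx 0 (piv y)).
exists (const_mx 1); split.
- by move=> y; exact: subdifferential_supsq.
- by rewrite argmin_supsq// => /matrixP/(_ 0 0)/eqP; rewrite !mxE oner_eq0.
move=> x x0E /(_ n (leqnn n)) xn.
(* Pigeonhole: [n] pivots cannot exhaust [n.+1] indices. *)
have [j jpiv] : exists j, j \notin mkseq (piv \o x) n.
  by apply: exists_notin; rewrite // size_mkseq card_ord.
have : (x n - x 0%N) 0 j = 0.
  apply: span_coord_eq0 xn => _ /mapP[i i_n ->].
  rewrite !mxE eqxx; case: eqP => [jE|_]; last by rewrite mulr0.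
  by move: jpiv; rewrite jE map_f.
rewrite x0E !mxE => /subr0_eq xnj.
rewrite minval_supsq// argmin_supsq// dist2_set1 !subr0 sqr_norm2.
(* The squared distance [n.+1] cancels the factor [1 / n.+1%:R], leaving [L / 2 <= supsq (x n)],
   which follows from coordinate [j] of [x n] being still 1. *)
rewrite /inner (eq_bigr (fun=> 1)) => [|i _]; last by rewrite !mxE mulr1.
rewrite sumr_const card_ord -mulrA mul1r mulVf ?pnatr_eq0// mulr1.
apply: ler_peMr; first by rewrite divr_ge0// ltW.
apply: exprn_ege1.
by rewrite (le_trans _ (ler_coord_norm _ j))// xnj normr1.
Qed.
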